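(* Let $G_0$ be a finite two-player game with pure strategy sets $S_1^{0},S_2^{0}$ and utilities $u^{0}=(u^0_1,u^0_2)$. Let $G$ be the game where: (i) first, player 1 selects $s_1\in S_1^{0}$ and player 2 observes this choice; (ii) next, player 2 selects a pure strategy $s_2\in S_2^{0}$, where player 2 must select a Pareto-optimal response to $s_1$ (but is not required to best-respond), i.e., $s_2$ must be such that every $s_2'\in S_2^{0}$ satisfies $u^0_1(s_1,s_2')\le u^0_1(s_1,s_2)$ or $u^0_2(s_1,s_2')\le u^0_2(s_1,s_2)$; (iii) the players receive utilities $u^0_i(s_1,s_2)$. Then enabling mixed-strategy simulation does not introduce Pareto-improving Nash equilibria in $G$.
   Context: A two-player normal-form game (NFG) $G=(S_1,S_2,u)$ has nonempty pure strategy sets $S_1,S_2$ and $u=(u_1,u_2):S_1\times S_2\to\mathbb R^2$. $\Sigma_i=\Delta(S_i)$ is the set of mixed strategies, $u$ is extended by expectation, $\mathrm{NE}(G)$ is the set of Nash equilibria. For $\sigma_2\in\Sigma_2$, $\mathrm{br}(\sigma_2)\subseteq S_1$ is the set of pure best responses of player 1 and $\text{f-br}(\sigma_2)=\arg\max_{t_1\in \mathrm{br}(\sigma_2)}u_2(t_1,\sigma_2)$. The sequential game $G$ of the claim is viewed as a normal-form game in the standard way: player 1's pure strategies are $S_1^0$, and player 2's pure strategies are the functions assigning to each $s_1\in S_1^0$ an allowed (Pareto-optimal) response in $S_2^0$. For a simulation cost $c>0$, the mixed-strategy simulation game $G^c_{\text{m-sim}}$ is the (infinite) NFG in which player 1's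 pure strategies are $S_1\cup\{\text{m-sim}\}$, player 2's pure strategies are $\Sigma_2$ (all mixed strategies of player 2 in $G$), $u(s_1,\sigma_2)$ is as in $G$ for $s_1\in S_1$, and $$u_1(\text{m-sim},\sigma_2)=u_1(\mathrm{br}(\sigma_2),\sigma_2)-c,\qquad u_2(\text{m-sim},\sigma_2)=u_2(\text{f-br}(\sigma_2),\sigma_2).$$ Mixed strategies of player 2 in $G^c_{\text{m-sim}}$ are (Borel) probability distributions over $\Sigma_2$; Nash equilibria are defined as usual. ''Enabling mixed-strategy simulation introduces Pareto-improving Nash equilibria in $G$'' means: there is $c_0>0$ such that for every $0<c<c_0$ the game $G^c_{\text{m-sim}}$ has a Nash equilibrium $\mu^*$ with $u_i(\mu^* )>u_i(\sigma)$ for both $i\in\{1,2\}$ and every $\sigma\in \mathrm{NE}(G)$. *)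

(* Defs.v *)
From HB Require Import structures.
From mathcomp Require Import all_boot all_order all_algebra.
From mathcomp Require Import all_classical all_reals all_analysis.

Set Implicit Arguments.
Unset Strict Implicit.
Unset Printing Implicit Defensive.

Import Order.TTheory GRing.Theory Num.Theory.
Import numFieldNormedType.Exports.

Local Open Scope classical_set_scope.
Local Open Scope ring_scope.

Section MixedStrategies.
Variables (R : realType) (S : finType).

Definition simplex : set {ptws S -> R} :=
  [set p | (forall s, 0 <= p s) /\ \sum_(s : S) p s = 1].

(* [set_type] carries the topology induced by the product topology R^S. *)
Definition mixed : Type := set_type simplex.

HB.instance Definition _ := Topological.copy mixed (set_type simplex).

Definition prob (p : mixed) (s : S) : R := \val p s.

Definition dirac_fun (s : S) : {ptws S -> R} := fun t => (t == s)%:R.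

Lemma dirac_fun_simplex (s : S) : dirac_fun s \in simplex.
Proof.
apply/mem_set; split=> [t|]; first by rewrite /dirac_fun ler0n.
rewrite (bigD1 s) //= /dirac_fun eqxx big1 ?addr0 // => t /negPf ts.
by rewrite ts.
Qed.

Definition pure (s : S) : mixed := exist _ (dirac_fun s) (dirac_fun_simplex s).

End MixedStrategies.

Record finite_game (R : realType) := FiniteGame {
  S1 : finType;
  S2 : finType;
  S1_gt0 : (0 < #|S1|)%N;
  S2_gt0 : (0 < #|S2|)%N;
  u1 : S1 -> S2 -> R;
  u2 : S1 -> S2 -> R }.
Arguments u1 {R} f _ _.
Arguments u2 {R} f _ _.

(* [X1], [X2] are the (mixed) strategy spaces of the two players and
   [U1], [U2] their expected payoffs. *)
Definition is_nash (R : realType) (X1 X2 : Type) (U1 U2 : X1 -> X2 -> R)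
    (x1 : X1) (x2 : X2) : Prop :=
  (forall y1, U1 y1 x2 <= U1 x1 x2) /\ (forall y2, U2 x1 y2 <= U2 x1 x2).

Section FiniteGame.
Variables (R : realType) (G : finite_game R).

Definition Sigma1 : Type := mixed R (S1 G).
Definition Sigma2 : Type := mixed R (S2 G).

HB.instance Definition _ := Topological.copy Sigma2 (mixed R (S2 G)).

Definition S2_point : S2 G := enum_val (Ordinal (S2_gt0 G)).

HB.instance Definition _ := isPointed.Build Sigma2 (pure R S2_point).

Definition pure_payoff1 (s1 : S1 G) (sigma2 : Sigma2) : R :=
  \sum_(s2 : S2 G) prob sigma2 s2 * u1 G s1 s2.
Definition pure_payoff2 (s1 : S1 G) (sigma2 : Sigma2) : R :=
  \sum_(s2 : S2 G) prob sigma2 s2 * u2 G s1 s2.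

Definition payoff1 (sigma1 : Sigma1) (sigma2 : Sigma2) : R :=
  \sum_(s1 : S1 G) prob sigma1 s1 * pure_payoff1 s1 sigma2.
Definition payoff2 (sigma1 : Sigma1) (sigma2 : Sigma2) : R :=
  \sum_(s1 : S1 G) prob sigma1 s1 * pure_payoff2 s1 sigma2.

Definition NE (sigma1 : Sigma1) (sigma2 : Sigma2) : Prop :=
  is_nash payoff1 payoff2 sigma1 sigma2.

Definition br (sigma2 : Sigma2) : {set S1 G} :=
  [set s1 | [forall t1, pure_payoff1 t1 sigma2 <= pure_payoff1 s1 sigma2]]%SET.

Definition fbr (sigma2 : Sigma2) : {set S1 G} :=
  [set s1 in br sigma2 |
    [forall t1 in br sigma2,
       pure_payoff2 t1 sigma2 <= pure_payoff2 s1 sigma2]]%SET.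

Lemma br_ex (sigma2 : Sigma2) : exists s1, s1 \in br sigma2.
Proof.
pose s0 : S1 G := enum_val (Ordinal (S1_gt0 G)).
have [s _ max_s] :=
  @arg_maxP _ _ _ s0 xpredT (fun s1 => pure_payoff1 s1 sigma2) isT.
by exists s; rewrite inE; apply/forallP => t; exact: max_s.
Qed.

Lemma fbr_ex (sigma2 : Sigma2) : exists s1, s1 \in fbr sigma2.
Proof.
have [s0 s0br] := br_ex sigma2.
have [s sbr max_s] :=
  @arg_maxP _ _ _ s0 (mem (br sigma2)) (fun s1 => pure_payoff2 s1 sigma2) s0br.
by exists s; rewrite inE; apply/andP; split=> //; apply/forall_inP.
Qed.

(* [pure_payoff1 _ sigma2] is constant on [br sigma2] and
   [pure_payoff2 _ sigma2] is constant on [fbr sigma2], so the payoffs of the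
   simulator do not depend on the elements picked by [xchoose]. *)
Definition br_payoff1 (sigma2 : Sigma2) : R :=
  pure_payoff1 (xchoose (br_ex sigma2)) sigma2.
Definition fbr_payoff2 (sigma2 : Sigma2) : R :=
  pure_payoff2 (xchoose (fbr_ex sigma2)) sigma2.

End FiniteGame.

Section MixedSimulation.
Variables (R : realType) (G : finite_game R) (c : R).

(* [Some s1] is the strategy [s1] of the original game, [None] is m-sim. *)
Definition msim_u1 (a : option (S1 G)) (sigma2 : Sigma2 G) : R :=
  if a is Some s1 then pure_payoff1 s1 sigma2 else br_payoff1 sigma2 - c.
Definition msim_u2 (a : option (S1 G)) (sigma2 : Sigma2 G) : R :=
  if a is Some s1 then pure_payoff2 s1 sigma2 else fbr_payoff2 sigma2.

Definition msim_mixed1 : Type := mixed R (option (S1 G)).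

Definition borel_Sigma2 := g_sigma_algebraType (@open (Sigma2 G)).

Definition msim_mixed2 : Type := probability borel_Sigma2 R.

(* The integrands are bounded Borel functions, so that the real-valued
   integrals below are genuine expectations. *)
Definition msim_payoff1 (p : msim_mixed1) (mu : msim_mixed2) : R :=
  \sum_(a : option (S1 G)) prob p a * \int[mu]_sigma2 msim_u1 a sigma2.
Definition msim_payoff2 (p : msim_mixed1) (mu : msim_mixed2) : R :=
  \sum_(a : option (S1 G)) prob p a * \int[mu]_sigma2 msim_u2 a sigma2.

Definition msim_NE (p : msim_mixed1) (mu : msim_mixed2) : Prop :=
  is_nash msim_payoff1 msim_payoff2 p mu.

End MixedSimulation.

Definition msim_introduces_pareto_improving_NE
    (R : realType) (G : finite_game R) : Prop :=
  exists2 c0 : R, 0 < c0 &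
    forall c : R, 0 < c < c0 ->
      exists (p : msim_mixed1 G) (mu : msim_mixed2 G),
        msim_NE c p mu /\
        forall (sigma1 : Sigma1 G) (sigma2 : Sigma2 G), NE sigma1 sigma2 ->
          payoff1 sigma1 sigma2 < msim_payoff1 c p mu /\
          payoff2 sigma1 sigma2 < msim_payoff2 p mu.

Section SequentialGame.
Variables (R : realType) (G0 : finite_game R).

Definition pareto_response (s1 : S1 G0) (s2 : S2 G0) : bool :=
  [forall s2' : S2 G0,
     (u1 G0 s1 s2' <= u1 G0 s1 s2) || (u2 G0 s1 s2' <= u2 G0 s1 s2)].

Definition pareto_policy : finType :=
  {f : {ffun S1 G0 -> S2 G0} | [forall s1, pareto_response s1 (f s1)]}.

Lemma pareto_response_ex (s1 : S1 G0) : exists s2, pareto_response s1 s2.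
Proof.
have [s _ max_s] := @arg_maxP _ _ _ (S2_point G0) xpredT (u1 G0 s1) isT.
by exists s; apply/forallP => t; apply/orP; left; exact: max_s.
Qed.

Lemma pareto_policy_gt0 : (0 < #|pareto_policy|)%N.
Proof.
pose f := [ffun s1 => xchoose (pareto_response_ex s1)].
have fP : [forall s1, pareto_response s1 (f s1)].
  by apply/forallP => s1; rewrite ffunE; exact: xchooseP.
by apply/card_gt0P; exists (exist _ f fP : pareto_policy).
Qed.

Definition sequential_game : finite_game R := {|
  S1 := S1 G0;
  S2 := pareto_policy;
  S1_gt0 := S1_gt0 G0;
  S2_gt0 := pareto_policy_gt0;
  u1 := fun s1 (f : pareto_policy) => u1 G0 s1 (val f s1);
  u2 := fun s1 (f : pareto_policy) => u2 G0 s1 (val f s1) |}.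

End SequentialGame.

(* Main.v *)
Require Import Defs.
From mathcomp Require Import all_boot all_order all_algebra.
From mathcomp Require Import all_classical all_reals all_analysis.
From mathcomp Require Import measurable_realfun lra.

Set Implicit Arguments.
Unset Strict Implicit.
Unset Printing Implicit Defensive.

Import Order.TTheory GRing.Theory Num.Theory.
Import numFieldNormedType.Exports.

Local Open Scope classical_set_scope.
Local Open Scope ring_scope.

(* Let [d] be a policy of player 2 that best responds to every [s1], and let
   [v] be the largest payoff player 1 can get against [d]. Whenever a mixed
   policy is optimal for player 2 at [s1] and gives player 1 at least [v] there,
   replacing it by [d] off [s1] yields an equilibrium of [G] with the same
   outcome at [s1].
   Suppose an equilibrium of the simulation game beats all equilibria of [G];
   player 1 then gets more than [v] from every strategy in their support. Take a
   mixed policy [x] in the support of player 2 for which the simulator's choice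
   [s] pays player 1 more than [v]. Replacing [x] by [d] off [s], and moving it
   slightly towards [d] at [s], keeps [s] the only best response and never hurts
   player 2. Since [x] is optimal, it must already be optimal for player 2 at [s]
   (if player 1 simulates) and at every pure strategy in the support of player 1.
   Choosing [x] so that a given strategy in this support earns more than [v]
   shows that its outcome is that of an equilibrium of [G]. Hence against each of
   them player 2 gets less than in the simulation game, contradicting that the
   payoff in that game is their average. *)

(** * Integration against a probability measure *)

(** The nonnegative function [k - g] has integral zero, so [g = k] almost everywhere. If [f <= b]
    held wherever [g = k], the integral of [f] would be at most [b]. *)
Lemma Rintegral_lt_ex (d : measure_display) (T : measurableType d)
    (R : realType) (mu : probability T R) (f g : T -> R) (b k : R) :
  mu.-integrable setT (EFin \o f) -> mu.-integrable setT (EFin \o g) ->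
  (forall x, g x <= k) -> k <= \int[mu]_x g x -> b < \int[mu]_x f x ->
  exists2 x, b < f x & g x = k.
Proof.
move=> intf intg gk kg bf.
have intc (r : R) : mu.-integrable setT (EFin \o cst r).
  exact: finite_measure_integrable_cst.
have int_cst (r : R) : \int[mu]_x cst r x = r.
  by rewrite Rintegral_cst// [X in fine X](probability_setT mu) mulr1.
apply: contrapT => noex.
have fb x : g x = k -> f x <= b.
  by move=> gx; rewrite leNgt; apply/negP => bfx; apply: noex; exists x.
have mf := measurable_int _ intf.
have intkg : mu.-integrable setT (EFin \o (fun x => k - g x)).
  rewrite (_ : _ \o _ = ((EFin \o cst k) \- (EFin \o g))%E)//.
  exact: integrableB.
have kg0 : \int[mu]_x (k - g x) = 0.
  rewrite (@RintegralB _ _ _ mu setT (cst k) g)// int_cst.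
  apply/eqP; rewrite subr_eq0 eq_le kg /= -[leRHS](int_cst k).
  exact: le_Rintegral.
have ae0 : ae_eq mu setT (EFin \o (fun x => k - g x)) (cst 0%E).
  apply/ae_eq_integral_abs => //; first exact: measurable_int intkg.
  rewrite (eq_integral (EFin \o (fun x => k - g x))); last first.
    by move=> x _ /=; rewrite ger0_norm// subr_ge0.
  rewrite -[LHS]fineK; last exact: integrable_fin_num.
  by rewrite -[fine _]/(\int[mu]_x (k - g x)) kg0.
(* [h] agrees with [f] almost everywhere and is bounded by [b] everywhere, so monotonicity of the
   integral applies to it pointwise. *)
pose h x : R := Num.min (f x) b.
have mh : measurable_fun [set: T] h.
  by apply: measurable_minr => //; exact/measurable_EFinP.
have /measurable_EFinP mfb := mh.
have ffb : ae_eq mu setT (EFin \o f) (EFin \o h).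
  apply: filterS ae0 => x /= /(_ I) [] /subr0_eq /esym gx _.
  by rewrite /h minEle fb.
have intfb : mu.-integrable setT (EFin \o h).
  have intg2 := integrableD measurableT (integrable_abse intf)
    (integrable_abse (intc b)).
  apply: le_integrable intg2 => // x _ /=.
  rewrite lee_fin [leRHS]ger0_norm ?addr_ge0// /h minEle.
  by case: ifP => _; rewrite ?lerDl ?lerDr.
suff: \int[mu]_x f x <= b by rewrite leNgt bf.
rewrite /Rintegral (ae_eq_integral (EFin \o h)) // -[leRHS]int_cst.
by apply: le_Rintegral => // x _; rewrite ge_min lexx orbT.
Qed.

Lemma integrable_lincomb (d : measure_display) (T : measurableType d)
    (R : realType) (mu : probability T R) (I : finType) (c : I -> R)
    (F : I -> T -> R) : (forall i, mu.-integrable setT (EFin \o F i)) ->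
  mu.-integrable setT (EFin \o (fun x => \sum_i c i * F i x)) /\
  \int[mu]_x (\sum_i c i * F i x) = \sum_i c i * \int[mu]_x F i x.
Proof.
move=> intF; elim: (index_enum I) => [|i s [IHint IHeq]].
  rewrite big_nil; split.
    rewrite (_ : _ \o _ = EFin \o cst 0); last first.
      by apply/funext => x /=; rewrite big_nil.
    exact: finite_measure_integrable_cst.
  under eq_Rintegral do rewrite big_nil.
  by rewrite Rintegral_cst// mul0r.
have intcF : mu.-integrable setT (EFin \o (fun x => c i * F i x)).
  by have := integrableZl measurableT (c i) (intF i).
split.
  apply: eq_integrable (integrableD measurableT intcF IHint) => // x _ /=.
  by rewrite big_cons.
under eq_Rintegral do rewrite big_cons.
by rewrite RintegralD// RintegralZl// IHeq big_cons.
Qed.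

(** Meant for payoffs defined through [xchoose]: the sets [D i] may overlap, since [h] agrees with
    [F i] on all of [D i], and preimages under [h] are finite unions. *)
Lemma measurable_fun_select (d d' : measure_display) (T : measurableType d)
    (U : measurableType d') (I : finType) (D : I -> set T) (F : I -> T -> U)
    (h : T -> U) :
  (forall i, measurable (D i)) -> (forall i, measurable_fun setT (F i)) ->
  (forall x, exists i, D i x) -> (forall x i, D i x -> h x = F i x) ->
  measurable_fun setT h.
Proof.
move=> mD mF exD hF _ Y mY; rewrite setTI.
rewrite (_ : h @^-1` Y = \bigcup_i (D i `&` F i @^-1` Y)).
  apply: fin_bigcup_measurable => [|i _]; first exact: finite_finset.
  by apply: measurableI => //; rewrite -[_ @^-1` _]setTI; exact: mF.
apply/seteqP; split=> [x hY|x [i _ [Dix FY]]]; last by rewrite /= (hF _ i).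
by have [i Dix] := exD x; exists i => //; split; rewrite //= -(hF _ i).
Qed.

(** * Expectations under finite mixed strategies *)

Section MixedExpectation.
Variables (R : realType) (S : finType).
Implicit Types (p : mixed R S) (w : S -> R).

Lemma prob_ge0 p s : 0 <= prob p s.
Proof. have /set_mem[h _] := valP p; exact: h. Qed.

Lemma prob_sum1 p : \sum_s prob p s = 1.
Proof. have /set_mem[_ h] := valP p; exact: h. Qed.

Lemma normr_expectation_le p w :
  `|\sum_s prob p s * w s| <= \sum_s `|w s|.
Proof.
apply: le_trans (ler_norm_sum _ _ _) _; apply: ler_sum => s _.
rewrite normrM ger0_norm ?prob_ge0// ler_piMl//.
by rewrite -(prob_sum1 p) (bigD1 s)//= lerDl sumr_ge0// => t _; exact: prob_ge0.
Qed.

Lemma expectation_pure (s : S) w : \sum_t prob (pure R s) t * w t = w s.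
Proof.
rewrite (bigD1 s)//= {1}/prob /= /dirac_fun eqxx mul1r big1 ?addr0// => t.
by move=> /negPf ts; rewrite /prob /= /dirac_fun ts mul0r.
Qed.

Lemma expectation_cst p (k : R) : \sum_s prob p s * k = k.
Proof. by rewrite -mulr_suml prob_sum1 mul1r. Qed.

Lemma expectation_le p w w' :
  (forall s, w s <= w' s) -> \sum_s prob p s * w s <= \sum_s prob p s * w' s.
Proof. by move=> h; apply: ler_sum => s _; rewrite ler_wpM2l// prob_ge0. Qed.

Lemma expectation_eq_le p w w' s :
  (forall t, w t <= w' t) ->
  \sum_t prob p t * w' t <= \sum_t prob p t * w t ->
  0 < prob p s -> w s = w' s.
Proof.
move=> ww' le_sum ps.
have /eqP : \sum_t prob p t * (w' t - w t) = 0.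
  apply/le_anti/andP; split; last first.
    by apply: sumr_ge0 => t _; rewrite mulr_ge0 ?prob_ge0// subr_ge0.
  by under eq_bigr do rewrite mulrBr; rewrite sumrB subr_le0.
rewrite psumr_eq0 => [/allP/(_ s (mem_index_enum _)) /=|t _]; last first.
  by rewrite mulr_ge0 ?prob_ge0// subr_ge0.
by rewrite mulf_eq0 (gt_eqF ps) subr_eq0 => /eqP.
Qed.

Lemma prob_supp p : exists s, 0 < prob p s.
Proof.
apply: contrapT => nex; have := prob_sum1 p; rewrite big1 => [/eqP|s _].
  by rewrite eq_sym oner_eq0.
apply/le_anti; rewrite prob_ge0 andbT leNgt.
by apply/negP => ps; apply: nex; exists s.
Qed.

(** [q] draws from the push-forward of [p] under [h] with probability [1 - l] and plays [d] with
    probability [l]. *)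
Lemma mixed_image (p : mixed R S) (h : S -> S) (d : S) (l : R) :
  0 <= l <= 1 -> exists q : mixed R S, forall w,
    \sum_s prob q s * w s = (1 - l) * (\sum_s prob p s * w (h s)) + l * w d.
Proof.
move=> /andP[l0 l1].
pose q : {ptws S -> R} :=
  fun s => (1 - l) * (\sum_(t | h t == s) prob p t) + l * (s == d)%:R.
have qE w : \sum_s q s * w s =
    (1 - l) * (\sum_s prob p s * w (h s)) + l * w d.
  under eq_bigr do rewrite mulrDl.
  rewrite big_split /=; congr (_ + _).
    under eq_bigr do rewrite -mulrA mulr_suml.
    rewrite -mulr_sumr; congr (_ * _).
    rewrite [RHS](partition_big h xpredT)//=; apply: eq_bigr => s _.
    by apply: eq_bigr => t /eqP ->.
  rewrite (bigD1 d)//= eqxx mulr1 big1 ?addr0// => s /negPf ->.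
  by rewrite mulr0 mul0r.
have qP : q \in @simplex R S.
  apply/mem_set; split=> [s|].
    rewrite addr_ge0 ?mulr_ge0 ?subr_ge0 ?ler0n// sumr_ge0// => t _.
    exact: prob_ge0.
  have := qE (fun=> 1); under eq_bigr do rewrite mulr1.
  by move=> ->; rewrite expectation_cst !mulr1 subrK.
by exists (exist _ q qP).
Qed.

End MixedExpectation.

(** * Measurability of the simulation payoffs and supports of equilibria *)

Section MsimMeasurability.
Variables (R : realType) (G : finite_game R).
Local Notation X := (borel_Sigma2 G).

Lemma measurable_prob (s2 : S2 G) :
  measurable_fun [set: X] (fun sigma2 : X => prob sigma2 s2).
Proof.
apply: (measurability _ (RGenOpens.measurableE R)) => _ [_ [a [b ->] <-]].
rewrite setTI; apply: sub_sigma_algebra.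
have/continuousP : continuous (fun sigma2 : Sigma2 G => prob sigma2 s2).
  move=> x.
  apply: (@continuous_comp _ _ _ (fun y : Sigma2 G => set_val y)
     (fun f => @proj _ (fun _ => R) s2 f)).
    exact: initial_continuous.
  exact: proj_continuous.
by apply; exact: interval_open.
Qed.

Lemma measurable_pure_payoff1 (s1 : S1 G) :
  measurable_fun [set: X] (pure_payoff1 s1 : X -> R).
Proof.
apply: measurable_sum => s2; apply: measurable_funM => //.
exact: measurable_prob.
Qed.

Lemma measurable_pure_payoff2 (s1 : S1 G) :
  measurable_fun [set: X] (pure_payoff2 s1 : X -> R).
Proof.
apply: measurable_sum => s2; apply: measurable_funM => //.
exact: measurable_prob.
Qed.

Lemma measurable_le_set (f g : X -> R) :
  measurable_fun setT f -> measurable_fun setT g ->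
  measurable [set x | f x <= g x].
Proof.
move=> mf mg.
have mfg := measurable_fun_ler mf mg.
rewrite -[mkset _]setTI.
exact: (mfg measurableT [set true] I).
Qed.

Lemma measurable_br (s1 : S1 G) : measurable [set x : X | s1 \in br x].
Proof.
rewrite (_ : mkset _ = \bigcap_(t1 in setT)
    [set x : X | pure_payoff1 t1 x <= pure_payoff1 s1 x]).
  apply: fin_bigcap_measurable => [|t1 _]; first exact: finite_finset.
  by apply: measurable_le_set; exact: measurable_pure_payoff1.
apply/seteqP; split=> x /=; rewrite inE => h.
  by move=> t1 _; move/forallP: h; exact.
by apply/forallP => t1; exact: h.
Qed.

Lemma measurable_fbr (s1 : S1 G) : measurable [set x : X | s1 \in fbr x].
Proof.
rewrite (_ : mkset _ = [set x : X | s1 \in br x] `&` \bigcap_(t1 in setT)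
    (~` [set x : X | t1 \in br x] `|`
     [set x : X | pure_payoff2 t1 x <= pure_payoff2 s1 x])).
  apply: measurableI; first exact: measurable_br.
  apply: fin_bigcap_measurable => [|t1 _]; first exact: finite_finset.
  apply: measurableU; first by apply: measurableC; exact: measurable_br.
  by apply: measurable_le_set; exact: measurable_pure_payoff2.
apply/seteqP; split=> x /=.
  rewrite inE => /andP[s1br /forall_inP h]; split => // t1 _.
  by have [/h|/negP] := boolP (t1 \in br x); [right|left].
move=> [s1br h]; rewrite inE; apply/andP; split => //.
apply/forall_inP => t1 t1br.
by have [|] := h t1 I.
Qed.

Lemma br_payoff1E (x : Sigma2 G) (s1 : S1 G) :
  s1 \in br x -> br_payoff1 x = pure_payoff1 s1 x.
Proof.
rewrite /br_payoff1; move: (xchoose _) (xchooseP (br_ex x)) => t1.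
rewrite !inE => /forallP ht /forallP hs.
by apply/eqP; rewrite eq_le ht hs.
Qed.

Lemma fbr_payoff2E (x : Sigma2 G) (s1 : S1 G) :
  s1 \in fbr x -> fbr_payoff2 x = pure_payoff2 s1 x.
Proof.
rewrite /fbr_payoff2; move: (xchoose _) (xchooseP (fbr_ex x)) => t1.
rewrite inE => /andP[t1br /forall_inP ht].
rewrite inE => /andP[s1br /forall_inP hs].
by apply/le_anti/andP; split; [exact: hs|exact: ht].
Qed.

Lemma measurable_msim_u1 (c : R) (a : option (S1 G)) :
  measurable_fun [set: X] (msim_u1 c a : X -> R).
Proof.
case: a => [s1|]; first exact: measurable_pure_payoff1.
apply: measurable_funB => //.
apply: (@measurable_fun_select _ _ X _ _ (fun s1 => [set x : X | s1 \in br x])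
  (fun s1 => pure_payoff1 s1)).
- exact: measurable_br.
- exact: measurable_pure_payoff1.
- exact: br_ex.
- exact: br_payoff1E.
Qed.

Lemma measurable_msim_u2 (a : option (S1 G)) :
  measurable_fun [set: X] (msim_u2 a : X -> R).
Proof.
case: a => [s1|]; first exact: measurable_pure_payoff2.
apply: (@measurable_fun_select _ _ X _ _ (fun s1 => [set x : X | s1 \in fbr x])
  (fun s1 => pure_payoff2 s1)).
- exact: measurable_fbr.
- exact: measurable_pure_payoff2.
- exact: fbr_ex.
- exact: fbr_payoff2E.
Qed.

Lemma bounded_integrable (mu : probability X R) (f : X -> R) (K : R) :
  measurable_fun setT f -> (forall x, `|f x| <= K) ->
  mu.-integrable setT (EFin \o f).
Proof.
move=> mf fK; apply: measurable_bounded_integrable => //.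
  by rewrite [X in (X < _)%E](probability_setT mu) ltry.
exists K; split; first by rewrite num_real.
by move=> M KM x _ /=; apply: le_trans (fK x) (ltW KM).
Qed.

Lemma integrable_msim_u1 (mu : msim_mixed2 G) (c : R) (a : option (S1 G)) :
  mu.-integrable setT (EFin \o (msim_u1 c a : X -> R)).
Proof.
pose K := \sum_(s1 : S1 G) \sum_(s2 : S2 G) `|u1 G s1 s2|.
have payK s1 (x : Sigma2 G) : `|pure_payoff1 s1 x| <= K.
  apply: le_trans (normr_expectation_le _ _) _.
  by rewrite /K (bigD1 s1)//= lerDl; do 2 rewrite sumr_ge0// => ? _.
apply: (@bounded_integrable _ _ (K + `|c|)); first exact: measurable_msim_u1.
case: a => [s1|] x /=; first by rewrite (le_trans (payK s1 x))// lerDl.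
by rewrite (le_trans (ler_normB _ _))// lerD2r; exact: payK.
Qed.

Lemma integrable_msim_u2 (mu : msim_mixed2 G) (a : option (S1 G)) :
  mu.-integrable setT (EFin \o (msim_u2 a : X -> R)).
Proof.
pose K := \sum_(s1 : S1 G) \sum_(s2 : S2 G) `|u2 G s1 s2|.
have payK s1 (x : Sigma2 G) : `|pure_payoff2 s1 x| <= K.
  apply: le_trans (normr_expectation_le _ _) _.
  by rewrite /K (bigD1 s1)//= lerDl; do 2 rewrite sumr_ge0// => ? _.
apply: (@bounded_integrable _ _ K); first exact: measurable_msim_u2.
by case: a => [s1|] x /=; exact: payK.
Qed.

(** What player 2 expects from committing to [x]; averaging it over [mu] gives
    [msim_payoff2 p mu]. *)
Definition msim_interim2 (p : msim_mixed1 G) (x : Sigma2 G) : R :=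
  \sum_a prob p a * msim_u2 a x.

Lemma msim_payoff2_dirac (p : msim_mixed1 G) (x : Sigma2 G) :
  msim_payoff2 p (dirac (x : X) : probability X R) = msim_interim2 p x.
Proof.
apply: eq_bigr => a _; congr (_ * _).
rewrite /Rintegral integral_dirac//; last first.
  by apply/measurable_EFinP; exact: measurable_msim_u2.
by rewrite diracT mul1e.
Qed.

(* Every deviation of player 2 to a single mixed strategy is a Dirac measure,
   so the interim payoff is at most the equilibrium payoff everywhere, hence
   equal to it almost everywhere. *)
Lemma msim_NE_support (c : R) (p : msim_mixed1 G) (mu : msim_mixed2 G) (b : R)
    (a : option (S1 G)) :
  msim_NE c p mu -> 0 < prob p a -> b < msim_payoff1 c p mu ->
  exists x : Sigma2 G, [/\ b < msim_u1 c a x,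
    msim_interim2 p x = msim_payoff2 p mu &
    forall y, msim_interim2 p y <= msim_payoff2 p mu].
Proof.
move=> [NE1 NE2] pa bU.
have g_le y : msim_interim2 p y <= msim_payoff2 p mu.
  by rewrite -msim_payoff2_dirac; exact: NE2.
have dev b' : \int[mu]_x msim_u1 c b' x <= msim_payoff1 c p mu.
  apply: le_trans (NE1 (pure R b')).
  by rewrite /msim_payoff1 expectation_pure.
(* Complementary slackness for player 1: the equilibrium payoff is the [p]-average of terms that do
   not exceed it, so each term of positive weight attains it. *)
have slack : \int[mu]_x msim_u1 c a x = msim_payoff1 c p mu.
  have : \sum_b' prob p b' * (msim_payoff1 c p mu - \int[mu]_x msim_u1 c b' x)
      = 0.
    under eq_bigr do rewrite mulrBr.
    by rewrite sumrB expectation_cst subrr.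
  move/eqP; rewrite psumr_eq0; last first.
    by move=> b' _; rewrite mulr_ge0 ?prob_ge0// subr_ge0.
  move=> /allP/(_ a (mem_index_enum _)) /=.
  by rewrite mulf_eq0 (gt_eqF pa)/= subr_eq0 => /eqP.
have [int2 eq2] := integrable_lincomb (prob p) (integrable_msim_u2 mu).
have [| |x bx gx] := @Rintegral_lt_ex _ X R mu _ _ b (msim_payoff2 p mu)
  (integrable_msim_u1 mu c a) int2 g_le.
- by rewrite eq2.
- by rewrite slack.
- by exists x; split.
Qed.

End MsimMeasurability.

(** * Splicing policies of player 2 *)

Section Splicing.
Variables (R : realType) (G : finite_game R).
(** [d] stands for the best-responding policy and [splice s f] for the policy that follows [f] at
    [s] and [d] elsewhere; both are described only through payoffs. *)
Variables (d : S2 G) (splice : S1 G -> S2 G -> S2 G).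
Hypothesis d_max2 : forall s f, u2 G s f <= u2 G s d.
Hypothesis splice_at1 : forall s f, u1 G s (splice s f) = u1 G s f.
Hypothesis splice_at2 : forall s f, u2 G s (splice s f) = u2 G s f.
Hypothesis splice_off1 :
  forall s t f, t != s -> u1 G t (splice s f) = u1 G t d.
Hypothesis splice_off2 :
  forall s t f, t != s -> u2 G t (splice s f) = u2 G t d.

Lemma pure_payoff2_le s (x : Sigma2 G) : pure_payoff2 s x <= u2 G s d.
Proof. by rewrite -(expectation_cst x (u2 G s d)); exact: expectation_le. Qed.

(** Splice every policy drawn from [x], then mix in [d] with weight [l]; off [s] both ingredients
    pay as [d] does. Equilibria are built with [l = 0], profitable deviations with [l > 0]. *)
Lemma splice_mix s (x : Sigma2 G) (l : R) : 0 <= l <= 1 ->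
  exists y : Sigma2 G,
    [/\ pure_payoff1 s y = (1 - l) * pure_payoff1 s x + l * u1 G s d,
        pure_payoff2 s y = (1 - l) * pure_payoff2 s x + l * u2 G s d,
        forall t, t != s -> pure_payoff1 t y = u1 G t d &
        forall t, t != s -> pure_payoff2 t y = u2 G t d].
Proof.
move=> l01; have [y yE] := mixed_image x (splice s) d l01; exists y.
split=> [||t ts|t ts]; rewrite /pure_payoff1 /pure_payoff2 yE.
- by under eq_bigr do rewrite splice_at1.
- by under eq_bigr do rewrite splice_at2.
- under eq_bigr do rewrite splice_off1//.
  by rewrite expectation_cst -mulrDl subrK mul1r.
- under eq_bigr do rewrite splice_off2//.
  by rewrite expectation_cst -mulrDl subrK mul1r.
Qed.

Lemma NE_splice s (x : Sigma2 G) :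
  (forall t, u1 G t d <= pure_payoff1 s x) -> pure_payoff2 s x = u2 G s d ->
  exists (s1 : Sigma1 G) (s2 : Sigma2 G), [/\ NE s1 s2,
    payoff1 s1 s2 = pure_payoff1 s x & payoff2 s1 s2 = u2 G s d].
Proof.
move=> ge_x x2.
have [|y [y1 y2 off1 _]] := @splice_mix s x 0; first by rewrite lexx ler01.
rewrite subr0 mul1r mul0r addr0 in y1; rewrite subr0 mul1r mul0r addr0 x2 in y2.
exists (pure R s), y; rewrite /NE /is_nash.
have -> : payoff1 (pure R s) y = pure_payoff1 s x.
  by rewrite /payoff1 expectation_pure.
have p2 z : payoff2 (pure R s) z = pure_payoff2 s z.
  by rewrite /payoff2 expectation_pure.
split; rewrite ?p2//; split=> [p|z]; last first.
  by rewrite !p2 y2; exact: pure_payoff2_le.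
rewrite -(expectation_cst p (pure_payoff1 s x)); apply: expectation_le => t.
by have [->|ts] := eqVneq t s; [rewrite y1|rewrite off1].
Qed.

(** A spliced and shifted policy [y] is at least as good as [x] for player 2 against every action,
    so maximality of [x] forces equality on the support of [p]. *)
Lemma msim_interim2_max (p : msim_mixed1 G) (x : Sigma2 G) s (v : R) :
  (forall t, u1 G t d <= v) -> v < pure_payoff1 s x -> s \in fbr x ->
  (forall y, msim_interim2 p y <= msim_interim2 p x) ->
  forall a, 0 < prob p a -> msim_u2 a x = u2 G (odflt s a) d.
Proof.
move=> le_v v_lt s_fbr x_max.
set m := pure_payoff1 s x in v_lt.
have del_gt0 : 0 < m - u1 G s d by rewrite subr_gt0 (le_lt_trans (le_v s)).
(* This weight puts player 1's payoff from [s] against [y] at the midpoint of [v] and [m], still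
   above [v]. *)
pose l := (m - v) / (m - u1 G s d) / 2.
have l_gt0 : 0 < l by rewrite !divr_gt0// subr_gt0.
have l_le1 : l <= 1.
  rewrite /l ler_pdivrMr// mul1r ler_pdivrMr//.
  by have := le_v s; have := del_gt0; lra.
have [|y [y1 y2 off1 off2]] := @splice_mix s x l; first by rewrite (ltW l_gt0).
have v_lty : v < pure_payoff1 s y.
  have lE : l * (m - u1 G s d) = (m - v) / 2.
    by rewrite /l mulrAC divfK// gt_eqF.
  by rewrite y1 -/m; move: lE v_lt; lra.
have s_bry : s \in br y.
  rewrite inE; apply/forallP => t.
  have [->//|ts] := eqVneq t s.
  by rewrite off1// (le_trans (le_v t))// ltW.
(* No other strategy is a best response to [y], so the tie-breaking of [fbr] is vacuous. *)
have s_fbry : s \in fbr y.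
  rewrite inE s_bry; apply/forall_inP => t; rewrite inE => /forallP/(_ s).
  have [->//|ts] := eqVneq t s; rewrite (off1 t)// => h.
  by have := lt_le_trans v_lty (le_trans h (le_v t)); rewrite ltxx.
have fbrx := fbr_payoff2E s_fbr; have fbry := fbr_payoff2E s_fbry.
have le_xy a : msim_u2 a x <= msim_u2 a y.
  have le_s : pure_payoff2 s x <= pure_payoff2 s y.
    have : 0 <= l * (u2 G s d - pure_payoff2 s x).
      by rewrite mulr_ge0 ?subr_ge0 ?pure_payoff2_le// ltW.
    by rewrite y2; lra.
  case: a => [t|] /=; last by rewrite fbrx fbry.
  have [->//|ts] := eqVneq t s.
  by rewrite off2// pure_payoff2_le.
move=> a pa.
have := expectation_eq_le le_xy (x_max y) pa.
(* Here [l > 0] matters: the shift towards [d] is a strict gain at [s] unless [x] is already optimal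
   there. *)
have eq_s : pure_payoff2 s x = pure_payoff2 s y -> pure_payoff2 s x = u2 G s d.
  move=> e; have /eqP : l * (u2 G s d - pure_payoff2 s x) = 0.
    by move: e; rewrite y2; lra.
  by rewrite mulf_eq0 (gt_eqF l_gt0) subr_eq0 => /eqP.
case: a {pa} => [t|] /=; last by rewrite fbrx fbry.
by have [->//|ts] := eqVneq t s; rewrite (off2 t).
Qed.

Lemma splicing_no_pareto_improving_NE :
  ~ msim_introduces_pareto_improving_NE G.
Proof.
move=> [c0 c0_gt0 /(_ (c0 / 2))]; set c := c0 / 2 => hc.
have c_gt0 : 0 < c by rewrite divr_gt0.
have {hc} [|p [mu [mu_NE better]]] := hc.
  by rewrite c_gt0 /c /=; move: c0_gt0; lra.
set U1 := msim_payoff1 c p mu in better; set U2 := msim_payoff2 p mu in better.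
have [t0 _ t0_max] : exists2 t0, true & forall t, u1 G t d <= u1 G t0 d.
  have [t _ h] := @arg_maxP _ _ _ (enum_val (Ordinal (S1_gt0 G))) xpredT
    (fun t => u1 G t d) isT.
  by exists t => // ?; exact: h.
pose v := u1 G t0 d.
have NE_better s x : v <= pure_payoff1 s x -> pure_payoff2 s x = u2 G s d ->
    pure_payoff1 s x < U1 /\ u2 G s d < U2.
  move=> vx x2.
  have [|s1 [s2 [/better lt_U <- <-]]] := @NE_splice s x _ x2 => //.
    by move=> t; apply: le_trans (t0_max t) vx.
have pure_d s : pure_payoff1 s (pure R d) = u1 G s d /\
    pure_payoff2 s (pure R d) = u2 G s d.
  by rewrite /pure_payoff1 /pure_payoff2 !expectation_pure.
(* [t0] against [d] has the outcome of an equilibrium of [G], with payoff [v] for player 1. *)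
have v_U1 : v < U1.
  have [e1 e2] := pure_d t0.
  by have [] := NE_better t0 (pure R d); rewrite ?e1 ?e2.
have supp a : 0 < prob p a -> exists x s, [/\ s \in fbr x,
    v < pure_payoff1 s x, v < msim_u1 c a x, msim_interim2 p x = U2 &
    forall b, 0 < prob p b -> msim_u2 b x = u2 G (odflt s b) d].
  move=> pa; have [x [vx xU2 x_max]] := msim_NE_support mu_NE pa v_U1.
  have [s s_fbr] := fbr_ex x; exists x, s.
  have s_br : s \in br x by move: s_fbr; rewrite inE => /andP[].
  (* The best response [s] earns at least what [a] earns, also when [a] is m-sim, which pays the
     cost [c] on top. *)
  have vs : v < pure_payoff1 s x.
    apply: lt_le_trans vx _; case: a {pa} => [t|] /=.
      by move: s_br; rewrite inE => /forallP.
    by rewrite (br_payoff1E s_br) gerBl ltW.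
  split=> //; apply: msim_interim2_max vs s_fbr _ => //.
  by move=> y; rewrite xU2.
(* The policy [x] is chosen anew for each [t], so that [t] itself earns more than [v]; the resulting
   bound no longer mentions [x]. *)
have supp_lt t : 0 < prob p (Some t) -> u2 G t d < U2.
  move=> pt; have [x [s [_ _ /= vt _ /(_ _ pt) /= x2]]] := supp _ pt.
  by have [] := NE_better t x (ltW vt) x2.
have none_lt x s : s \in fbr x -> v < pure_payoff1 s x ->
    fbr_payoff2 x = u2 G s d -> u2 G s d < U2.
  move=> s_fbr vs; rewrite (fbr_payoff2E s_fbr) => x2.
  by have [] := NE_better s x (ltW vs) x2.
(* A single [x] is now fixed: player 2 gets less than [U2] against every action in the support of
   [p], yet averages exactly [U2]. *)
have [a pa] := prob_supp p.
have [x [s [s_fbr vs _ xU2 x2]]] := supp _ pa.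
have lt_b b : 0 < prob p b -> msim_u2 b x < U2.
  move=> pb; rewrite x2//; case: b pb => [t|] pb /=; first exact: supp_lt.
  by apply: (none_lt x) => //; have := x2 _ pb.
suff : msim_interim2 p x < U2 by rewrite xU2 ltxx.
rewrite -[ltRHS](expectation_cst p) /msim_interim2.
rewrite (bigD1 a)//= [ltRHS](bigD1 a)//= ltr_leD ?ltr_pM2l ?lt_b//.
apply: ler_sum => b _; have := prob_ge0 p b; rewrite le_eqVlt.
by case/predU1P => [<-|pb]; rewrite ?mul0r// ler_pM2l// ltW// lt_b.
Qed.

End Splicing.

(** * Policies of the sequential game *)

Section SequentialSplicing.
Variables (R : realType) (G0 : finite_game R).

(** A response maximizing player 2's own utility is Pareto-optimal, hence allowed. *)
Lemma best_response_policy : exists d : pareto_policy G0,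
  forall s q, u2 G0 s q <= u2 G0 s (val d s).
Proof.
have best s : exists r, forall q, u2 G0 s q <= u2 G0 s r.
  have [r _ h] := @arg_maxP _ _ _ (S2_point G0) xpredT (u2 G0 s) isT.
  by exists r => q; exact: h.
have [r rP] := choice best.
have dP : [forall s, pareto_response s ([ffun s => r s] s)].
  apply/forallP => s; apply/forallP => q.
  by rewrite ffunE rP orbT.
by exists (exist _ [ffun s => r s] dP) => s q; rewrite /= ffunE.
Qed.

Definition splice_fun (d : pareto_policy G0) s (f : pareto_policy G0) :
    {ffun S1 G0 -> S2 G0} :=
  [ffun t => if t == s then val f t else val d t].

(** The Pareto constraint is imposed at each strategy of player 1 separately, so it survives
    splicing. *)
Lemma splice_fun_pareto d s f :
  [forall t, pareto_response t (splice_fun d s f t)].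
Proof.
apply/forallP => t; rewrite ffunE.
by case: ifP => _; [have /forallP := valP f|have /forallP := valP d].
Qed.

Definition splice_policy d s f : pareto_policy G0 :=
  exist _ (splice_fun d s f) (splice_fun_pareto d s f).

Lemma splice_policy_at d s f : val (splice_policy d s f) s = val f s.
Proof. by rewrite /= ffunE eqxx. Qed.

Lemma splice_policy_off d s t f :
  t != s -> val (splice_policy d s f) t = val d t.
Proof. by rewrite /= ffunE => /negPf ->. Qed.

End SequentialSplicing.

Theorem theorem5p1 (R : realType) (G0 : finite_game R) :
  ~ msim_introduces_pareto_improving_NE (sequential_game G0).
Proof.
have [d d_best] := best_response_policy G0.
apply: (@splicing_no_pareto_improving_NE _ (sequential_game G0) d
  (splice_policy d)) => [s f|s f|s f|s t f ts|s t f ts].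
- exact: d_best.
- by rewrite /= splice_policy_at.
- by rewrite /= splice_policy_at.
- by rewrite /= splice_policy_off.
- by rewrite /= splice_policy_off.
Qed.
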